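(* Let $k$ be a field, let $A$ be a $k$-algebra, let $H$ be a weak Hopf algebra over $k$ with bijective antipode $S$, and let $\rho\colon H\otimes A\to A$, written $h\cdot a:=\rho(h\otimes a)$, and $\sigma\colon H\otimes_{H^R}H\to A$ be maps. Let $\varsigma:=\sigma\circ p$, where $p\colon H\otimes H\to H\otimes_{H^R}H$ is the canonical surjection. Assume that for all $h,k,m\in H$, $l\in H^L$ and $a,a'\in A$ the following conditions hold: (1) $h\cdot 1_A=\Pi^L(h)\cdot 1_A$; (2) $h\cdot(aa')=(h^{(1)}\cdot a)(h^{(2)}\cdot a')$; (3) $S^{-1}(l)h\cdot a=(h\cdot a)(l\cdot 1_A)$ and $lh\cdot a=(l\cdot 1_A)(h\cdot a)$; (4) $1\cdot a=a$; (5) $\sigma(lh,k)=(l\cdot 1_A)\sigma(h,k)$ and $\sigma(S^{-1}(l)h,k)=\sigma(h,k)(l\cdot 1_A)$; (6) $(h^{(1)}\cdot(l\cdot 1_A))\sigma(h^{(2)},k)=\sigma(h,lk)$; (7) $\sigma(1,h)=\sigma(h,1)=h\cdot 1_A$; (8) $(h^{(1)}\cdot\sigma(k^{(1)},m^{(1)}))\sigma(h^{(2)},k^{(2)}m^{(2)})=\sigma(h^{(1)},k^{(1)})\sigma(h^{(2)}k^{(2)},m)$; (9) $(h^{(1)}\cdot(k^{(1)}\cdot a))\sigma(h^{(2)},k^{(2)})=\sigma(h^{(1)},k^{(1)})(h^{(2)}k^{(2)}\cdot a)$; (10) $h\cdot(l\cdot 1_A)=hl\cdot 1_A$ (for $h\in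 H$, $l\in H^L$). Let $i\colon A\times^{\rho}_{\varsigma}H\to A\otimes H$ be the canonical inclusion and let $\pi\colon A\otimes H\to A\#^{\rho}_{\sigma}H$ be the canonical surjection. Then the map $\psi\colon A\times^{\rho}_{\varsigma}H\to A\#^{\rho}_{\sigma}H$ defined by $\psi:=\pi\circ i$ is a left $A$-linear and right $H$-colinear algebra isomorphism.
   Context: Conventions: $\otimes=\otimes_k$, maps are $k$-linear, algebras are associative and unital. The Sweedler notation $\Delta(h)=h^{(1)}\otimes h^{(2)}$ (summation omitted) is used; in particular $\Delta(1)=1^{(1)}\otimes 1^{(2)}$, and primes denote a second copy of $\Delta(1)$. The expression $hk\cdot a$ means $(hk)\cdot a$. A weak bialgebra is a $k$-vector space $H$ with an algebra structure and a coalgebra structure (with comultiplication $\Delta$ and counit $\epsilon$) such that $\Delta(hl)=\Delta(h)\Delta(l)$, $\Delta^2(1)=1^{(1)}\otimes 1^{(2)}1^{(1')}\otimes 1^{(2')}=1^{(1)}\otimes 1^{(1')}1^{(2)}\otimes 1^{(2')}$ (where $\Delta^2=(\Delta\otimes \mathrm{id})\circ\Delta$), and $\epsilon(hlm)=\epsilon(hl^{(1)})\epsilon(l^{(2)}m)=\epsilon(hl^{(2)})\epsilon(l^{(1)}m)$ for all $h,l,m\in H$. Set $\Pi^L(h):=\epsilon(1^{(1)}h)1^{(2)}$ and $\Pi^R(h):=1^{(1)}\epsilon(h1^{(2)})$; these are idempotent maps $H\to H$, and their images $H^L:=\mathrm{Im}(\Pi^L)$ and $H^R:=\mathrm{Im}(\Pi^R)$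 are subalgebras of $H$. An antipode is a map $S\colon H\to H$ with $h^{(1)}S(h^{(2)})=\Pi^L(h)$, $S(h^{(1)})h^{(2)}=\Pi^R(h)$ and $S(h^{(1)})h^{(2)}S(h^{(3)})=S(h)$ for all $h$; it is unique if it exists. A weak Hopf algebra is a weak bialgebra with an antipode. The tensor product $H\otimes_{H^R}H$ is formed using right and left multiplication by the subalgebra $H^R$, and $\sigma(h,k)$ stands for $\sigma(h\otimes_{H^R}k)$. The algebra $A\#^{\rho}_{\sigma}H$: regard $A$ as a right $H^L$-module via $a\cdot l:=a(l\cdot 1_A)$ and $H$ as a left $H^L$-module by multiplication. Under the conditions above, the vector space $A\otimes_{H^L}H$ is an associative algebra with unit $1_A\otimes_{H^L}1$ via $(a\otimes_{H^L}h)(b\otimes_{H^L}k):=a(h^{(1)}\cdot b)\sigma(h^{(2)},k^{(1)})\otimes_{H^L}h^{(3)}k^{(2)}$; this algebra is $A\#^{\rho}_{\sigma}H$. It is a left $A$-module via the natural action on the first factor and a right $H$-comodule via $a\otimes_{H^L}h\mapsto (a\otimes_{H^L}h^{(1)})\otimes h^{(2)}$. The algebra $A\times^{\rho}_{\varsigma}H$: let $\nabla_\rho\colon A\otimes H\to A\otimes H$ be the map $\nabla_\rho(a\otimes h):=a(h^{(1)}\cdot 1_A)\otimes h^{(2)}$, let $A\times H:=\mathrm{Im}(\nabla_\rho)$ and $a\times h:=\nabla_\rho(a\otimes h)$. Under the conditions above, $A\times H$ is an associative algebra with unit $1_A\times 1$ via $(a\times h)(b\times k):=a(h^{(1)}\cdot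 b)\varsigma(h^{(2)}\otimes k^{(1)})\times h^{(3)}k^{(2)}$; this algebra is $A\times^{\rho}_{\varsigma}H$. It is a left $A$-module via the natural action on the first factor and a right $H$-comodule via $a\times h\mapsto (a\times h^{(1)})\otimes h^{(2)}$. *)

(* Defs.v *)
From HB Require Import structures.
From mathcomp Require Import all_boot all_order all_algebra.
From mathcomp Require Import boolp.
From mathcomp Require Import generic_quotient ring_quotient freeg.

Set Implicit Arguments.
Unset Strict Implicit.
Unset Printing Implicit Defensive.

Import GRing.Theory.

Local Open Scope ring_scope.
Local Open Scope quotient_scope.

Section VQuot.
Variables (k : fieldType) (V : lmodType k) (G : V -> Prop).

Inductive span : V -> Prop :=
| span0 : span 0
| spanZD a u v : G u -> span v -> span (a *: u + v).

Lemma spanD u v : span u -> span v -> span (u + v).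
Proof.
elim=> [|a w u' Gw _ IH] sv; first by rewrite add0r.
by rewrite -addrA; apply: spanZD => //; exact: IH.
Qed.

Lemma spanZ a u : span u -> span (a *: u).
Proof.
elim=> [|b w u' Gw _ IH]; first by rewrite scaler0; exact: span0.
by rewrite scalerDr scalerA; exact: spanZD.
Qed.

Lemma span_gen u : G u -> span u.
Proof.
by move=> Gu; have := spanZD 1 Gu span0; rewrite scale1r addr0.
Qed.

Definition spanb : {pred V} := fun x => `[< span x >].

Lemma spanb_zmod_closed : zmod_closed spanb.
Proof.
split=> [|u v /asboolP su /asboolP sv]; apply/asboolP; first exact: span0.
by rewrite -scaleN1r; apply: spanD => //; exact: spanZ.
Qed.

HB.instance Definition _ := GRing.isZmodClosed.Build V spanb spanb_zmod_closed.

Definition vquot : Type := Quotient.quot (spanb : zmodClosed V).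

HB.instance Definition _ := Choice.on vquot.
HB.instance Definition _ := GRing.Zmodule.on vquot.

Definition vpi (x : V) : vquot := \pi_(Quotient.quot (spanb : zmodClosed V)) x.
Definition vrepr (x : vquot) : V :=
  repr (x : Quotient.quot (spanb : zmodClosed V)).

Lemma vreprK x : vpi (vrepr x) = x.
Proof. exact: reprK. Qed.

Lemma vpi_eq x y : vpi x = vpi y <-> span (x - y).
Proof.
have E : (x - y \in spanb) = (vpi x == vpi y).
  exact: (Quotient.idealrBE (spanb : zmodClosed V)).
split=> [e|s]; first by apply/asboolP; move: E; rewrite e eqxx.
by apply/eqP; rewrite -E; exact/asboolP.
Qed.

Lemma vpiD x y : vpi (x + y) = vpi x + vpi y.
Proof. exact: (Quotient.pi_add (spanb : zmodClosed V)). Qed.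

Definition vscale (a : k) (x : vquot) : vquot := vpi (a *: vrepr x).

Lemma vpiZ a x : vpi (a *: x) = vscale a (vpi x).
Proof.
by apply/vpi_eq; rewrite -scalerBr; apply/spanZ/vpi_eq; rewrite vreprK.
Qed.

Lemma vscaleA a b x : vscale a (vscale b x) = vscale (a * b) x.
Proof. by rewrite -[x]vreprK -!vpiZ scalerA. Qed.

Lemma vscale1 x : vscale 1 x = x.
Proof. by rewrite -[x]vreprK -vpiZ scale1r. Qed.

Lemma vscaleDr a x y : vscale a (x + y) = vscale a x + vscale a y.
Proof. by rewrite -[x]vreprK -[y]vreprK -vpiD -!vpiZ -vpiD scalerDr. Qed.

Lemma vscaleDl x a b : vscale (a + b) x = vscale a x + vscale b x.
Proof. by rewrite -[x]vreprK -!vpiZ -vpiD scalerDl. Qed.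

HB.instance Definition _ := GRing.Zmodule_isLmodule.Build k vquot
  vscaleA vscale1 vscaleDr vscaleDl.

Lemma vpi_is_linear : linear vpi.
Proof. by move=> a x y; rewrite vpiD vpiZ. Qed.

HB.instance Definition _ := GRing.isLinear.Build k V vquot *:%R vpi vpi_is_linear.

Lemma vpi_gen x : G x -> vpi x = 0.
Proof. by move=> Gx; rewrite -(linear0 vpi); apply/vpi_eq; rewrite subr0; exact: span_gen. Qed.

Lemma vrepr_gen (U : lmodType k) (f : {linear V -> U}) :
  (forall x, G x -> f x = 0) -> forall x, f (vrepr (vpi x)) = f x.
Proof.
move=> f0 x; apply/eqP; rewrite -subr_eq0 -linearB; apply/eqP.
have /vpi_eq : vpi (vrepr (vpi x)) = vpi x by rewrite vreprK.
elim=> [|a u v Gu _ IH]; first exact: linear0.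
by rewrite linearP f0 // IH scaler0 addr0.
Qed.

End VQuot.

Definition bilinear_map (k : fieldType) (V W U : lmodType k)
    (f : V -> W -> U) : Prop :=
  (forall w, linear (f^~ w)) /\ (forall v, linear (f v)).

Section FreeModule.
Variables (R : nzRingType) (K : choiceType).

Definition freemod : Type := {freeg K / R}.
HB.instance Definition _ := GRing.Lmodule.on freemod.

Definition fgen (z : K) : freemod := << z >>.

Lemma freemod_sum (x : freemod) : x = \sum_(z <- dom x) coeff z x *: fgen z.
Proof.
rewrite -[LHS]freeg_sumE; apply: eq_bigr => z _ /=.
by apply/eqP/freeg_eqP => t; rewrite coeffZ !coeffU mul1r.
Qed.

Variables (U : lmodType R) (f : K -> U).

Definition flift (x : freemod) : U := fglift f x.

Lemma flift_gen z : flift (fgen z) = f z.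
Proof. by rewrite /flift liftU scale1r. Qed.

Lemma flift_is_linear : linear flift.
Proof.
pose g : {additive freemod -> U} := HB.pack flift
  (GRing.isZmodMorphism.Build freemod U flift (lift_is_additive f)).
have gU c z : g (c *: fgen z) = c *: f z.
  suff -> : c *: fgen z = << c *g z >> :> freemod by exact: liftU.
  by apply/eqP/freeg_eqP => t; rewrite coeffZ !coeffU mul1r.
have gZ a x : g (a *: x) = a *: g x.
  rewrite [x]freemod_sum scaler_sumr !raddf_sum.
  by apply: eq_bigr => z _; rewrite scalerA gU -scalerA -gU.
by move=> a x y; rewrite -[flift]/(g : _ -> _) raddfD gZ.
Qed.

HB.instance Definition _ :=
  GRing.isLinear.Build R freemod U *:%R flift flift_is_linear.

End FreeModule.

Arguments fgen {R K} z.

Section Tensor.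
Variables (k : fieldType) (V W : lmodType k).

Local Notation gen p := (@fgen k (V * W)%type p).

Inductive tensor_rel : freemod k (V * W)%type -> Prop :=
| TensorRelL a v v' w :
    tensor_rel (gen (a *: v + v', w) - (a *: gen (v, w) + gen (v', w)))
| TensorRelR a v w w' :
    tensor_rel (gen (v, a *: w + w') - (a *: gen (v, w) + gen (v, w'))).

Definition tensor : Type := vquot tensor_rel.
HB.instance Definition _ := GRing.Lmodule.on tensor.

Definition tpure (v : V) (w : W) : tensor := vpi tensor_rel (gen (v, w)).

(* For bilinear f this is the image of t under the linear map on the tensor
   product induced by f (lemmas tsumE and tsum_is_linear); for other f the
   value depends on the choice of a representative of t. *)
Definition tsum (U : lmodType k) (t : tensor) (f : V -> W -> U) : U :=
  flift (fun p => f p.1 p.2) (vrepr t).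

End Tensor.

Arguments tpure {k V W} v w.

Notation "v \ox w" := (tpure v w) (at level 40, left associativity) : ring_scope.

Notation "\tsum_ ( x , y <- t ) E" := (tsum t (fun x y => E))
  (at level 41, E at level 41, t at level 35, x binder, y binder,
   format "'[' \tsum_ ( x ,  y  <-  t ) '/  '  E ']'") : ring_scope.

Section TensorTheory.
Variables (k : fieldType) (V W : lmodType k).

Lemma tpure_bilinear : bilinear_map (@tpure k V W).
Proof.
split=> [w|v] a x y; rewrite /tpure -linearP; apply/vpi_eq/span_gen.
  exact: TensorRelL.
exact: TensorRelR.
Qed.

Lemma tensor_span (t : tensor V W) :
  exists s : seq (V * W), t = \sum_(p <- s) p.1 \ox p.2.
Proof.
exists [seq (coeff p (vrepr t) *: p.1, p.2) | p <- dom (vrepr t)].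
rewrite big_map -[LHS]vreprK [in LHS](freemod_sum (vrepr t)) linear_sum.
apply: eq_bigr => -[v w] _ /=; rewrite linearZ /=.
set c := coeff _ _.
have l0 : (0 : V) \ox w = 0.
  by apply: (addrI (0 \ox w)); rewrite addr0 -{1}[0 \ox w]scale1r
     -(tpure_bilinear.1 w) scaler0 addr0.
by have := tpure_bilinear.1 w c v 0; rewrite /= l0 !addr0 => ->.
Qed.

Variables (U : lmodType k) (f : V -> W -> U).
Hypothesis f_bil : bilinear_map f.

Lemma flift_tensor_rel x :
  tensor_rel x -> flift (fun p : V * W => f p.1 p.2) x = 0.
Proof.
by case=> *; rewrite linearB linearP /= !flift_gen /= ?f_bil.1 ?f_bil.2 subrr.
Qed.

Lemma tsum_pi x :
  tsum (vpi (@tensor_rel k V W) x) f = flift (fun p : V * W => f p.1 p.2) x.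
Proof. by rewrite /tsum vrepr_gen //; exact: flift_tensor_rel. Qed.

Lemma tsumE v w : tsum (v \ox w) f = f v w.
Proof. by rewrite tsum_pi flift_gen. Qed.

Lemma tsum_is_linear : linear (fun t : tensor V W => tsum t f).
Proof.
move=> a x y; rewrite -[x]vreprK -[y]vreprK.
by rewrite -linearP !tsum_pi linearP.
Qed.

End TensorTheory.

Section BalancedTensor.
Variables (k : fieldType) (M N : lmodType k) (B : Type) (D : B -> Prop).
Variables (ra : M -> B -> M) (la : B -> N -> N).

Inductive balanced_rel : tensor M N -> Prop :=
| BalancedRel m b n : D b ->
    balanced_rel (ra m b \ox n - m \ox la b n).

Definition btensor : Type := vquot balanced_rel.
HB.instance Definition _ := GRing.Lmodule.on btensor.

Definition bpi : tensor M N -> btensor := vpi balanced_rel.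
HB.instance Definition _ := GRing.Linear.on bpi.

End BalancedTensor.

(* Algebras over a field.  The library's algType excludes the zero algebra,
   and a structure joining pzRingType with lmodType cannot be declared after
   it; so the product is that of a monoidType, written ** in ring_scope. *)
Notation "x ** y" := (x * y)%g (at level 40, left associativity) : ring_scope.

HB.mixin Record Monoid_isUnitalAlgebra (k : fieldType) A
    of Monoid A & GRing.Lmodule k A := {
  algMl : forall z : A, linear (fun x : A => x ** z);
  algMr : forall x : A, linear (fun y : A => x ** y)
}.

#[short(type="unitalAlgType")]
HB.structure Definition UnitalAlgebra (k : fieldType) :=
  {A of Monoid A & GRing.Lmodule k A & Monoid_isUnitalAlgebra k A}.

HB.mixin Record Lmodule_isCoalgebra (k : fieldType) C of GRing.Lmodule k C := {
  comul : {linear C -> tensor C C};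
  counit : {linear C -> k^o};
  comulA : forall x : C,
    \tsum_(y, x3 <- comul x) \tsum_(x1, x2 <- comul y) (x1 \ox (x2 \ox x3)) =
    \tsum_(x1, y <- comul x) \tsum_(x2, x3 <- comul y) (x1 \ox (x2 \ox x3));
  counitl : forall x : C, \tsum_(x1, x2 <- comul x) (counit x1 *: x2) = x;
  counitr : forall x : C, \tsum_(x1, x2 <- comul x) (counit x2 *: x1) = x
}.

#[short(type="coalgType")]
HB.structure Definition Coalgebra (k : fieldType) :=
  {C of GRing.Lmodule k C & Lmodule_isCoalgebra k C}.

Definition sweedler2 (k : fieldType) (C : coalgType k) (U : lmodType k)
    (x : C) (f : C -> C -> U) : U :=
  \tsum_(x1, x2 <- comul x) f x1 x2.

Definition sweedler3 (k : fieldType) (C : coalgType k) (U : lmodType k)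
    (x : C) (f : C -> C -> C -> U) : U :=
  \tsum_(y, x3 <- comul x) \tsum_(x1, x2 <- comul y) f x1 x2 x3.

(* Sweedler notation: x ranges over the coalgebra, and the bound variables
   stand for the legs of its iterated coproduct. *)
Notation "\sw_ ( x1 , x2 <- x ) E" := (sweedler2 x (fun x1 x2 => E))
  (at level 41, E at level 41, x at level 35, x1 binder, x2 binder,
   format "'[' \sw_ ( x1 ,  x2  <-  x ) '/  '  E ']'") : ring_scope.
Notation "\sw_ ( x1 , x2 , x3 <- x ) E" := (sweedler3 x (fun x1 x2 x3 => E))
  (at level 41, E at level 41, x at level 35, x1 binder, x2 binder, x3 binder,
   format "'[' \sw_ ( x1 ,  x2 ,  x3  <-  x ) '/  '  E ']'") : ring_scope.

HB.mixin Record isWeakBialgebra (k : fieldType) H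
    of UnitalAlgebra k H & Coalgebra k H := {
  comulM : forall h l : H,
    comul (h ** l) = \sw_(h1, h2 <- h) \sw_(l1, l2 <- l) ((h1 ** l1) \ox (h2 ** l2));
  comul2_1l :
    \sw_(x1, x2, x3 <- (1%g : H)) (x1 \ox x2 \ox x3) =
    \sw_(x1, x2 <- (1%g : H)) \sw_(y1, y2 <- (1%g : H)) (x1 \ox (x2 ** y1) \ox y2);
  comul2_1r :
    \sw_(x1, x2, x3 <- (1%g : H)) (x1 \ox x2 \ox x3) =
    \sw_(x1, x2 <- (1%g : H)) \sw_(y1, y2 <- (1%g : H)) (x1 \ox (y1 ** x2) \ox y2);
  counitMl : forall h l m : H,
    counit (h ** l ** m) = \sw_(l1, l2 <- l) (counit (h ** l1) * counit (l2 ** m));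
  counitMr : forall h l m : H,
    counit (h ** l ** m) = \sw_(l1, l2 <- l) (counit (h ** l2) * counit (l1 ** m))
}.

#[short(type="weakBialgType")]
HB.structure Definition WeakBialgebra (k : fieldType) :=
  {H of UnitalAlgebra k H & Coalgebra k H & isWeakBialgebra k H}.

Definition PiL (k : fieldType) (H : weakBialgType k) (h : H) : H :=
  \sw_(x1, x2 <- (1%g : H)) ((counit (x1 ** h) : k) *: x2).

Definition PiR (k : fieldType) (H : weakBialgType k) (h : H) : H :=
  \sw_(x1, x2 <- (1%g : H)) ((counit (h ** x2) : k) *: x1).

Definition inHL (k : fieldType) (H : weakBialgType k) (l : H) : Prop :=
  exists h : H, l = PiL h.

Definition inHR (k : fieldType) (H : weakBialgType k) (r : H) : Prop :=
  exists h : H, r = PiR h.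

HB.mixin Record isWeakHopf (k : fieldType) H of WeakBialgebra k H := {
  antipode : {linear H -> H};
  antipodeL : forall h : H, \sw_(h1, h2 <- h) (h1 ** antipode h2) = PiL h;
  antipodeR : forall h : H, \sw_(h1, h2 <- h) (antipode h1 ** h2) = PiR h;
  antipodeLR : forall h : H,
    \sw_(h1, h2, h3 <- h) (antipode h1 ** h2 ** antipode h3) = antipode h
}.

#[short(type="weakHopfType")]
HB.structure Definition WeakHopf (k : fieldType) :=
  {H of WeakBialgebra k H & isWeakHopf k H}.

Section TensorHR.
Variables (k : fieldType) (H : weakBialgType k).

Definition tensorHR : Type :=
  btensor (@inHR k H) (fun h r => h ** r) (fun r h => r ** h).
HB.instance Definition _ := GRing.Lmodule.on tensorHR.

Definition piHR : tensor H H -> tensorHR := @bpi _ _ _ _ _ _ _.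
HB.instance Definition _ := GRing.Linear.on piHR.

Definition varsigma (A : lmodType k) (sigma : tensorHR -> A) (t : tensor H H) : A :=
  sigma (piHR t).

Definition pureHR (h h' : H) : tensorHR := piHR (h \ox h').

End TensorHR.

Notation "h \oxR h'" := (pureHR h h') (at level 40, left associativity) : ring_scope.

Section BilinearTheory.
Variable k : fieldType.

Lemma linearf_bilinear (V W U : lmodType k) (f : {linear tensor V W -> U}) :
  bilinear_map (fun v w => f (v \ox w)).
Proof.
by split=> [w|v] a x y; rewrite ?(tpure_bilinear _ _).1 ?(tpure_bilinear _ _).2 linearP.
Qed.

Lemma eq_tsum (V W U : lmodType k) (f g : V -> W -> U) t :
  (forall v w, f v w = g v w) -> tsum t f = tsum t g.
Proof. by move=> fg; congr (tsum _ _); apply/funext => v; apply/funext => w. Qed.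

Lemma tsum_linf (V W U : lmodType k) (f g : V -> W -> U) a t :
  tsum t (fun v w => a *: f v w + g v w) = a *: tsum t f + tsum t g.
Proof.
rewrite /tsum [vrepr t]freemod_sum !linear_sum -big_split /=; apply: eq_bigr => p _.
by rewrite !linearZ /= !flift_gen scalerDr !scalerA mulrC.
Qed.

End BilinearTheory.

Section Crossed.
Variables (k : fieldType) (A : unitalAlgType k) (H : weakHopfType k).
Variable rho : {linear tensor H A -> A}.

Definition nabla (t : tensor A H) : tensor A H :=
  \tsum_(a, h <- t) \sw_(h1, h2 <- h) ((a ** rho (h1 \ox 1%g)) \ox h2).

Lemma nabla_bilinear :
  bilinear_map (fun a h => \sw_(h1, h2 <- h) ((a ** rho (h1 \ox 1%g)) \ox h2)).
Proof.
split=> [h|a] c x y.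
  rewrite /sweedler2 -tsum_linf; apply: eq_tsum => h1 h2.
  by rewrite algMl (tpure_bilinear _ _).1.
rewrite /sweedler2 linearP tsum_is_linear //; split=> [h2|h1] d u v.
  rewrite (linearf_bilinear rho).1 algMr.
  exact: (tpure_bilinear _ _).1.
exact: (tpure_bilinear _ _).2.
Qed.

Lemma nabla_is_linear : linear nabla.
Proof. exact/tsum_is_linear/nabla_bilinear. Qed.

HB.instance Definition _ :=
  GRing.isLinear.Build k (tensor A H) (tensor A H) *:%R nabla nabla_is_linear.

Definition in_nabla : {pred tensor A H} := fun x => `[< exists y, x = nabla y >].

Lemma in_nablaP y : in_nabla (nabla y).
Proof. by apply/asboolP; exists y. Qed.

Lemma in_nabla_submod_closed : submod_closed in_nabla.
Proof.
split=> [|a x y /asboolP[x' ->] /asboolP[y' ->]].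
  by rewrite -(linear0 nabla); exact: in_nablaP.
by rewrite -linearP; exact: in_nablaP.
Qed.

HB.instance Definition _ :=
  GRing.isSubmodClosed.Build k (tensor A H) in_nabla in_nabla_submod_closed.

Record times : Type := Times { times_val : tensor A H; _ : in_nabla times_val }.
HB.instance Definition _ := [isSub for times_val].
HB.instance Definition _ := [Choice of times by <:].
HB.instance Definition _ := [SubChoice_isSubLmodule of times by <:].

Definition times_pure (a : A) (h : H) : times := Times (in_nablaP (a \ox h)).

Definition smash : Type :=
  btensor (@inHL k H) (fun (a : A) l => a ** rho (l \ox 1%g)) (fun l h => l ** h).
HB.instance Definition _ := GRing.Lmodule.on smash.

Definition smash_pi : tensor A H -> smash := @bpi _ _ _ _ _ _ _.
HB.instance Definition _ := GRing.Linear.on smash_pi.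

Definition smash_pure (a : A) (h : H) : smash := smash_pi (a \ox h).

Definition psi (x : times) : smash := smash_pi (times_val x).

(* Both algebras carry the same formulas, with pure a h standing for the
   element "a x h", respectively "a (x)_{H^L} h".  Since these elements span
   the space X, the operations are determined by the formulas; that they are
   well defined is part of the existence of such a structure. *)
Record crossed_product (cocycle : H -> H -> A) (X : lmodType k)
    (pure : A -> H -> X) : Type := CrossedProduct {
  cp_act : A -> X -> X;
  cp_mul : X -> X -> X;
  cp_one : X;
  cp_coact : X -> tensor X H;
  cp_act_bilinear : bilinear_map cp_act;
  cp_actE : forall a b h, cp_act a (pure b h) = pure (a ** b) h;
  cp_act1 : forall x, cp_act 1%g x = x;
  cp_actA : forall a b x, cp_act a (cp_act b x) = cp_act (a ** b) x;
  cp_mul_bilinear : bilinear_map cp_mul;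
  cp_mulE : forall a h b h',
    cp_mul (pure a h) (pure b h') =
    \sw_(h1, h2, h3 <- h) \sw_(k1, k2 <- h')
      pure (a ** rho (h1 \ox b) ** cocycle h2 k1) (h3 ** k2);
  cp_mulA : associative cp_mul;
  cp_oneE : cp_one = pure 1%g 1%g;
  cp_mul1 : left_id cp_one cp_mul;
  cp_mulr1 : right_id cp_one cp_mul;
  cp_coact_linear : linear cp_coact;
  cp_coactE : forall a h,
    cp_coact (pure a h) = \sw_(h1, h2 <- h) (pure a h1 \ox h2);
  cp_coactA : forall x,
    \tsum_(y, h2 <- cp_coact x) \tsum_(z, h1 <- cp_coact y) (z \ox (h1 \ox h2)) =
    \tsum_(y, h <- cp_coact x) \sw_(h1, h2 <- h) (y \ox (h1 \ox h2));
  cp_counit : forall x, \tsum_(y, h <- cp_coact x) (counit h *: y) = x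
}.

Record crossed_iso (cocycle cocycle' : H -> H -> A) (X Y : lmodType k)
    (pureX : A -> H -> X) (pureY : A -> H -> Y)
    (P : crossed_product cocycle pureX) (Q : crossed_product cocycle' pureY)
    (f : X -> Y) : Prop := CrossedIso {
  ciso_linear : linear f;
  ciso_bij : bijective f;
  ciso_mul : forall x y, f (cp_mul P x y) = cp_mul Q (f x) (f y);
  ciso_one : f (cp_one P) = cp_one Q;
  ciso_act : forall a x, f (cp_act P a x) = cp_act Q a (f x);
  ciso_coact : forall x,
    cp_coact Q (f x) = \tsum_(y, h <- cp_coact P x) (f y \ox h)
}.

End Crossed.

(* Main.v *)
(* Since Delta(1) lies in H^R (x) H^L, one has Pi^L(h_1) h_2 = h and
   Delta(l h) = l h_1 (x) h_2 for l in H^L.  By (1) and (3) this gives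
   pi o nabla = pi, and nabla kills the relations defining A (x)_{H^L} H;
   so nabla factors through pi and induces the inverse of psi.  As psi matches
   a x h with a (x)_{H^L} h, both algebras carry the same structure, and it is
   enough to check the axioms on A (x)_{H^L} H.  There the product is balanced
   by (3) on the left and by (2), (6) on the right; associativity is (9) followed
   by (8) and (2), and the unit laws follow from (2), (4)-(7) and the
   H^R-balancedness of sigma. *)
Require Import Defs.
From HB Require Import structures.
From mathcomp Require Import all_boot all_order all_algebra.
From mathcomp Require Import boolp freeg.

Set Implicit Arguments.
Unset Strict Implicit.
Unset Printing Implicit Defensive.

Import GRing.Theory.

Local Open Scope ring_scope.

Section Linearity.
Variables (k : fieldType) (U V W : lmodType k).

Lemma lin_id : linear (fun x : V => x).
Proof. by []. Qed.

Lemma lin_comp (g : V -> W) (f : U -> V) :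
  linear g -> linear f -> linear (fun x => g (f x)).
Proof. by move=> gl fl a x y; rewrite fl gl. Qed.

Lemma lin_fun (g : {linear V -> W}) (f : U -> V) :
  linear f -> linear (fun x => g (f x)).
Proof. exact/lin_comp/linearP. Qed.

Lemma lin_oxl (f : U -> V) (w : W) : linear f -> linear (fun x => f x \ox w).
Proof. by move=> fl a x y; rewrite fl (tpure_bilinear _ _).1. Qed.

Lemma lin_oxr (v : V) (f : U -> W) : linear f -> linear (fun x => v \ox f x).
Proof. by move=> fl a x y; rewrite fl (tpure_bilinear _ _).2. Qed.

Lemma lin_scalel (f : U -> k^o) (v : V) :
  linear f -> linear (fun x => (f x : k) *: v).
Proof. by move=> fl a x y; rewrite fl scalerDl scalerA. Qed.

Lemma lin_scaler (c : k) (f : U -> V) :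
  linear f -> linear (fun x => c *: f x).
Proof. by move=> fl a x y; rewrite fl scalerDr !scalerA mulrC. Qed.

Lemma lin_tsum (f : V -> W -> U) :
  (forall w, linear (f^~ w)) -> (forall v, linear (f v)) ->
  linear (fun t : tensor V W => tsum t f).
Proof. by move=> fl fr; apply: tsum_is_linear. Qed.

Lemma linZ (f : U -> V) c x : linear f -> f (c *: x) = c *: f x.
Proof.
move=> fl.
pose g : {linear U -> V} :=
  HB.pack f (GRing.isLinear.Build _ _ _ *:%R f fl).
by rewrite -[f]/(g : _ -> _) linearZ.
Qed.

End Linearity.

Section LinearityIn.
Variables (k : fieldType) (U V W X : lmodType k).

Lemma lin_tsum_in (t : tensor V W) (f : U -> V -> W -> X) :
  (forall v w, linear (fun x => f x v w)) ->
  linear (fun x => tsum t (f x)).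
Proof.
by move=> fl a x y; rewrite -tsum_linf; apply: eq_tsum => v w; exact: fl.
Qed.

Lemma tsum_sumE (t : tensor V W) (f : V -> W -> U) :
  tsum t f = \sum_(p <- dom (vrepr t)) coeff p (vrepr t) *: f p.1 p.2.
Proof.
rewrite /tsum [in LHS](freemod_sum (vrepr t)) linear_sum.
by apply: eq_bigr => p _; rewrite linearZ /= flift_gen.
Qed.

Lemma tsum_map (t : tensor V W) (f : V -> W -> U) (g : U -> X) :
  linear g -> g (tsum t f) = \tsum_(v, w <- t) g (f v w).
Proof.
move=> gl.
pose h : {linear U -> X} := HB.pack g (GRing.isLinear.Build k U X *:%R g gl).
rewrite -[g]/(h : _ -> _) /tsum [vrepr t]freemod_sum !linear_sum.
by apply: eq_bigr => p _; rewrite !linearZ /= !flift_gen.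
Qed.

Lemma tsum_ext (f g : tensor V W -> X) :
  linear f -> linear g -> (forall v w, f (v \ox w) = g (v \ox w)) -> f =1 g.
Proof.
move=> fl gl fg t.
pose f' : {linear tensor V W -> X} :=
  HB.pack f (GRing.isLinear.Build _ _ _ *:%R f fl).
pose g' : {linear tensor V W -> X} :=
  HB.pack g (GRing.isLinear.Build _ _ _ *:%R g gl).
have [s ->] := tensor_span t.
rewrite -[f]/(f' : _ -> _) -[g]/(g' : _ -> _) !linear_sum.
by apply: eq_bigr => p _; apply: fg.
Qed.

End LinearityIn.

Lemma lin_algl (k : fieldType) (U : lmodType k) (A : unitalAlgType k)
    (f : U -> A) (b : A) : linear f -> linear (fun x => f x ** b).
Proof. by move=> fl a x y; rewrite fl algMl. Qed.

Lemma lin_algr (k : fieldType) (U : lmodType k) (A : unitalAlgType k)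
    (b : A) (f : U -> A) : linear f -> linear (fun x => b ** f x).
Proof. by move=> fl a x y; rewrite fl algMr. Qed.

Section Sweedler.
Variables (k : fieldType) (C : coalgType k).

Lemma lin_sw (U W : lmodType k) (g : U -> C) (f : C -> C -> W) :
  linear g -> (forall w, linear (f^~ w)) -> (forall v, linear (f v)) ->
  linear (fun x => \sw_(x1, x2 <- g x) f x1 x2).
Proof.
move=> gl fl fr.
apply: (lin_comp (g := fun x => \sw_(x1, x2 <- x) f x1 x2)) => //.
apply: (lin_comp (g := fun t : tensor C C => tsum t f)); first exact: lin_tsum.
exact: linearP.
Qed.

Lemma lin_sw_in (U W : lmodType k) (c : C) (f : U -> C -> C -> W) :
  (forall v w, linear (fun x => f x v w)) ->
  linear (fun x => \sw_(x1, x2 <- c) f x x1 x2).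
Proof. exact: lin_tsum_in. Qed.

Variables (U : lmodType k).

Lemma eq_sw (f g : C -> C -> U) c :
  (forall v w, f v w = g v w) ->
  \sw_(x1, x2 <- c) f x1 x2 = \sw_(x1, x2 <- c) g x1 x2.
Proof. exact: eq_tsum. Qed.

Lemma sw_map (W : lmodType k) (g : U -> W) (f : C -> C -> U) c :
  linear g -> g (\sw_(x1, x2 <- c) f x1 x2) = \sw_(x1, x2 <- c) g (f x1 x2).
Proof. exact: tsum_map. Qed.

Lemma sw_exch (D : coalgType k) (f : C -> C -> D -> D -> U) c d :
  \sw_(x1, x2 <- c) \sw_(y1, y2 <- d) f x1 x2 y1 y2 =
  \sw_(y1, y2 <- d) \sw_(x1, x2 <- c) f x1 x2 y1 y2.
Proof.
rewrite /sweedler2 !tsum_sumE.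
under eq_bigr => p _ do rewrite tsum_sumE scaler_sumr.
under [RHS]eq_bigr => p _ do rewrite tsum_sumE scaler_sumr.
rewrite exchange_big; apply: eq_bigr => q _; apply: eq_bigr => p _.
by rewrite !scalerA mulrC.
Qed.

Lemma sw_counitl (f : C -> U) c :
  linear f -> \sw_(x1, x2 <- c) ((counit x1 : k) *: f x2) = f c.
Proof.
move=> fl; rewrite -{2}[c]counitl tsum_map //; apply: eq_sw => x1 x2.
by rewrite linZ.
Qed.

Lemma sw_counitr (f : C -> U) c :
  linear f -> \sw_(x1, x2 <- c) ((counit x2 : k) *: f x1) = f c.
Proof.
move=> fl; rewrite -{2}[c]counitr tsum_map //; apply: eq_sw => x1 x2.
by rewrite linZ.
Qed.

Lemma sw_coassoc (f : C -> C -> C -> U) c :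
  (forall y z, linear (fun x => f x y z)) ->
  (forall x z, linear (fun y => f x y z)) ->
  (forall x y, linear (f x y)) ->
  \sw_(y, x3 <- c) \sw_(x1, x2 <- y) f x1 x2 x3 =
  \sw_(x1, y <- c) \sw_(x2, x3 <- y) f x1 x2 x3.
Proof.
move=> f1 f2 f3.
have fb x : bilinear_map (f x) by split.
pose F (t : tensor C (tensor C C)) := tsum t (fun x s => tsum s (f x)).
have Fb : bilinear_map (fun x (s : tensor C C) => tsum s (f x)).
  by split=> [s|x]; [apply: lin_tsum_in => v w|apply: lin_tsum].
have Fl : linear F by exact: tsum_is_linear.
have FE x y z : F (x \ox (y \ox z)) = f x y z by rewrite /F !tsumE.
transitivity (F (\tsum_(y, x3 <- comul c) \tsum_(x1, x2 <- comul y)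
    (x1 \ox (x2 \ox x3)))).
  rewrite tsum_map //; apply: eq_tsum => y x3.
  by rewrite tsum_map //; apply: eq_tsum => x1 x2; rewrite FE.
rewrite comulA tsum_map //; apply: eq_tsum => x1 y.
by rewrite tsum_map //; apply: eq_tsum => x2 x3; rewrite FE.
Qed.

End Sweedler.

Ltac lin_hyp :=
  match goal with Hl : _ |- _ => first
    [ exact: Hl | apply: (lin_comp Hl) | apply: (lin_comp (Hl _))
    | apply: (lin_comp (Hl _ _)) | apply: (lin_comp (Hl _ _ _))
    | apply: (lin_comp (Hl _ _ _ _ _)) ] end.
(* Under an anonymous binder a pattern variable such as [?w] only matches terms
   in which the bound variable does not occur; under a named one it would
   capture them.  This selects the argument in which to prove linearity. *)
Ltac lin_ext f := fail.
Ltac lin_step :=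
  lazymatch goal with |- GRing.linear_for ?s ?f =>
  lazymatch f with
  | fun x => x => exact: lin_id
  | fun _ => _ \ox ?w => apply: lin_oxl
  | fun _ => ?v \ox _ => apply: lin_oxr
  | fun _ => _ ** ?b => apply: lin_algl
  | fun _ => ?a ** _ => apply: lin_algr
  | fun _ => _ *: ?v => apply: lin_scalel
  | fun _ => ?c *: _ => apply: lin_scaler
  | fun _ => sweedler2 _ ?g => apply: lin_sw
  | fun _ => sweedler2 ?c _ => apply: lin_sw_in
  | fun _ => GRing.Linear.sort ?g _ => apply: lin_fun
  | fun _ => _ => first [lin_ext f | lin_hyp]
  | _ => first [lin_hyp | change (GRing.linear_for s (fun x => f x))]
  end end.
Ltac lin := intros; cbn beta; solve [repeat (lin_step; intros; cbn beta)].

Section Regrouping.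
Variables (k : fieldType) (C : coalgType k) (U : lmodType k).

Lemma sw2_coassoc (f : C -> C -> C -> C -> C -> C -> U) h l :
  (forall h2 h3 l1 l2 l3, linear (fun x => f x h2 h3 l1 l2 l3)) ->
  (forall h1 h3 l1 l2 l3, linear (fun x => f h1 x h3 l1 l2 l3)) ->
  (forall h1 h2 l1 l2 l3, linear (fun x => f h1 h2 x l1 l2 l3)) ->
  (forall h1 h2 h3 l2 l3, linear (fun x => f h1 h2 h3 x l2 l3)) ->
  (forall h1 h2 h3 l1 l3, linear (fun x => f h1 h2 h3 l1 x l3)) ->
  (forall h1 h2 h3 l1 l2, linear (fun x => f h1 h2 h3 l1 l2 x)) ->
  \sw_(y, h3 <- h) \sw_(z, l3 <- l) \sw_(h1, h2 <- y) \sw_(l1, l2 <- z)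
    f h1 h2 h3 l1 l2 l3 =
  \sw_(h1, y <- h) \sw_(l1, z <- l) \sw_(h2, h3 <- y) \sw_(l2, l3 <- z)
    f h1 h2 h3 l1 l2 l3.
Proof.
move=> f1 f2 f3 f4 f5 f6.
transitivity (\sw_(y, h3 <- h) \sw_(h1, h2 <- y)
    \sw_(z, l3 <- l) \sw_(l1, l2 <- z) f h1 h2 h3 l1 l2 l3).
  by apply: eq_sw => y h3; rewrite sw_exch.
rewrite sw_coassoc; [|lin|lin|lin].
apply: eq_sw => h1 y; rewrite [RHS]sw_exch; apply: eq_sw => h2 h3.
by rewrite sw_coassoc.
Qed.

End Regrouping.

Section WeakBialgebraTheory.
Variables (k : fieldType) (H : weakBialgType k) (U : lmodType k).
Implicit Types h l x : H.

Lemma sw_mul (f : H -> H -> U) h l :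
  (forall x, linear (f^~ x)) -> (forall x, linear (f x)) ->
  \sw_(x1, x2 <- h ** l) f x1 x2 =
  \sw_(h1, h2 <- h) \sw_(l1, l2 <- l) f (h1 ** l1) (h2 ** l2).
Proof.
move=> fl fr; rewrite {1}/sweedler2 comulM.
have tl : linear (fun t : tensor H H => tsum t f) by exact: lin_tsum.
rewrite (sw_map _ _ tl); apply: eq_sw => h1 h2.
by rewrite (sw_map _ _ tl); apply: eq_sw => l1 l2; rewrite tsumE.
Qed.

Lemma sw1_mulr (f : H -> H -> U) h :
  (forall x, linear (f^~ x)) -> (forall x, linear (f x)) ->
  \sw_(h1, h2 <- h) \sw_(x1, x2 <- (1%g : H)) f (h1 ** x1) (h2 ** x2) =
  \sw_(h1, h2 <- h) f h1 h2.
Proof. by move=> fl fr; rewrite -sw_mul // mulg1. Qed.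

Lemma sw1_mull (f : H -> H -> U) h :
  (forall x, linear (f^~ x)) -> (forall x, linear (f x)) ->
  \sw_(x1, x2 <- (1%g : H)) \sw_(h1, h2 <- h) f (x1 ** h1) (x2 ** h2) =
  \sw_(h1, h2 <- h) f h1 h2.
Proof. by move=> fl fr; rewrite -sw_mul // mul1g. Qed.

Let sw_unit_tensor (f : H -> H -> H -> U) :
  (forall y z, linear (fun x => f x y z)) ->
  (forall x z, linear (fun y => f x y z)) ->
  (forall x y, linear (f x y)) ->
  exists F : tensor (tensor H H) H -> U,
    [/\ linear F, forall x y z, F ((x \ox y) \ox z) = f x y z &
      \sw_(x1, y <- (1%g : H)) \sw_(x2, x3 <- y) f x1 x2 x3 =
      F (\sw_(x1, x2, x3 <- (1%g : H)) (x1 \ox x2 \ox x3))].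
Proof.
move=> f1 f2 f3; exists (fun t => \tsum_(s, z <- t) \tsum_(x, y <- s) f x y z).
have b : bilinear_map (fun (s : tensor H H) z => \tsum_(x, y <- s) f x y z).
  by split=> [z|s]; [apply: lin_tsum|apply: lin_tsum_in].
have Fl := tsum_is_linear b.
split=> // [x y z|]; first by rewrite !tsumE.
rewrite -sw_coassoc // (tsum_map _ _ Fl); apply: eq_sw => y x3.
by rewrite (tsum_map _ _ Fl); apply: eq_sw => x1 x2; rewrite !tsumE.
Qed.

Lemma sw_unitl (f : H -> H -> H -> U) :
  (forall y z, linear (fun x => f x y z)) ->
  (forall x z, linear (fun y => f x y z)) ->
  (forall x y, linear (f x y)) ->
  \sw_(x1, y <- (1%g : H)) \sw_(x2, x3 <- y) f x1 x2 x3 =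
  \sw_(x1, x2 <- (1%g : H)) \sw_(y1, y2 <- (1%g : H)) f x1 (x2 ** y1) y2.
Proof.
move=> f1 f2 f3; have [F [Fl FE ->]] := sw_unit_tensor f1 f2 f3.
rewrite comul2_1l (sw_map _ _ Fl); apply: eq_sw => x1 x2.
by rewrite (sw_map _ _ Fl); apply: eq_sw => y1 y2; rewrite FE.
Qed.

Lemma sw_unitr (f : H -> H -> H -> U) :
  (forall y z, linear (fun x => f x y z)) ->
  (forall x z, linear (fun y => f x y z)) ->
  (forall x y, linear (f x y)) ->
  \sw_(x1, y <- (1%g : H)) \sw_(x2, x3 <- y) f x1 x2 x3 =
  \sw_(x1, x2 <- (1%g : H)) \sw_(y1, y2 <- (1%g : H)) f x1 (y1 ** x2) y2.
Proof.
move=> f1 f2 f3; have [F [Fl FE ->]] := sw_unit_tensor f1 f2 f3.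
rewrite comul2_1r (sw_map _ _ Fl); apply: eq_sw => x1 x2.
by rewrite (sw_map _ _ Fl); apply: eq_sw => y1 y2; rewrite FE.
Qed.

End WeakBialgebraTheory.

Section BaseAlgebras.
Variables (k : fieldType) (H : weakBialgType k).
Implicit Types h l x : H.

Lemma inHL1 : inHL (1%g : H).
Proof.
exists 1%g; rewrite /PiL -[LHS]counitl; apply: eq_sw => x1 x2.
by rewrite mulg1.
Qed.

Lemma PiL_mul h : \sw_(h1, h2 <- h) (PiL h1 ** h2) = h.
Proof.
rewrite -[RHS](sw_counitl h (@lin_id k H)) -[RHS]sw1_mull; [|lin|lin].
rewrite [RHS]sw_exch; apply: eq_sw => h1 h2.
have gl : linear (fun x : H => x ** h2) by lin.
rewrite /PiL (sw_map _ _ gl); apply: eq_sw => x1 x2.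
by rewrite (linZ _ _ gl).
Qed.

Variables (U : lmodType k) (f : H -> H -> U).
Hypotheses (fl : forall x, linear (f^~ x)) (fr : forall x, linear (f x)).

Lemma sw_HL_mul h l : inHL l ->
  \sw_(x1, x2 <- l ** h) f x1 x2 = \sw_(h1, h2 <- h) f (l ** h1) h2.
Proof.
case=> x ->{l}.
have sw_PiL (g : H -> H -> U) : (forall x, linear (g^~ x)) ->
    (forall x, linear (g x)) ->
    \sw_(y1, y2 <- PiL x) g y1 y2 =
    \sw_(y1, y2 <- (1%g : H)) g (PiL x ** y1) y2.
  move=> gl gr.
  have swl : linear (fun y : H => \sw_(y1, y2 <- y) g y1 y2) by lin.
  rewrite {1}/PiL (sw_map _ _ swl).
  transitivity (\sw_(x1, y <- (1%g : H)) \sw_(y1, y2 <- y)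
      ((counit (x1 ** x) : k) *: g y1 y2)).
    apply: eq_sw => x1 x2; rewrite (linZ _ _ swl).
    by rewrite (sw_map (g := fun u => _ *: u)) //; lin.
  rewrite sw_unitl; [|lin|lin|lin].
  rewrite sw_exch; apply: eq_sw => y1 y2.
  have gl' : linear (fun y : H => g (y ** y1) y2) by lin.
  rewrite /PiL (sw_map _ _ gl'); apply: eq_sw => x1 x2.
  by rewrite (linZ _ _ gl').
rewrite sw_mul // sw_PiL; [|lin|lin].
rewrite -[RHS]sw1_mull; [|lin|lin].
by apply: eq_sw => y1 y2; apply: eq_sw => h1 h2; rewrite mulgA.
Qed.

Lemma sw1_PiL :
  \sw_(x1, x2 <- (1%g : H)) f x1 (PiL x2) = \sw_(x1, x2 <- (1%g : H)) f x1 x2.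
Proof.
transitivity (\sw_(x1, y <- (1%g : H)) \sw_(y1, y2 <- y)
    ((counit y1 : k) *: f x1 y2)).
  rewrite sw_unitr; [|lin|lin|lin]; apply: eq_sw => x1 x2.
  have fl' := fr x1.
  rewrite /PiL (sw_map _ _ fl'); apply: eq_sw => y1 y2.
  by rewrite (linZ _ _ fl').
by apply: eq_sw => x1 x2; rewrite sw_counitl.
Qed.

Lemma sw1_PiR :
  \sw_(x1, x2 <- (1%g : H)) f (PiR x1) x2 = \sw_(x1, x2 <- (1%g : H)) f x1 x2.
Proof.
transitivity (\sw_(x1, y <- (1%g : H)) \sw_(y1, y2 <- y)
    ((counit y1 : k) *: f x1 y2)).
  rewrite sw_unitr; [|lin|lin|lin]; rewrite sw_exch; apply: eq_sw => x1 x2.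
  rewrite /PiR (sw_map _ _ (fl x2)); apply: eq_sw => y1 y2.
  by rewrite (linZ _ _ (fl x2)).
rewrite -sw_coassoc; [|lin|lin|lin].
by apply: eq_sw => x1 x2; rewrite (sw_counitr _ (fl x2)).
Qed.

End BaseAlgebras.

Lemma lin_vlift (k : fieldType) (V U : lmodType k) (G : V -> Prop)
    (f : V -> U) :
  linear f -> (forall x, G x -> f x = 0) ->
  (forall x, f (vrepr (vpi G x)) = f x) /\
  linear (fun x : vquot G => f (vrepr x)).
Proof.
move=> fl f0.
pose g : {linear V -> U} := HB.pack f (GRing.isLinear.Build _ _ _ *:%R f fl).
have fE x : f (vrepr (vpi G x)) = f x by exact: (vrepr_gen (f := g) f0).
split=> // a x y; rewrite -[x]vreprK -[y]vreprK -linearP !fE; exact: fl.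
Qed.

Lemma lin_HRl (k : fieldType) (U : lmodType k) (H : weakBialgType k)
    (f : U -> H) (h : H) : linear f -> linear (fun x => f x \oxR h).
Proof. by move=> fl; apply: lin_fun; apply: lin_oxl. Qed.

Lemma lin_HRr (k : fieldType) (U : lmodType k) (H : weakBialgType k)
    (h : H) (f : U -> H) : linear f -> linear (fun x => h \oxR f x).
Proof. by move=> fl; apply: lin_fun; apply: lin_oxr. Qed.

Lemma oxR_balanced (k : fieldType) (H : weakBialgType k) (h r l : H) :
  inHR r -> (h ** r) \oxR l = h \oxR (r ** l).
Proof.
move=> rR; apply/eqP; rewrite -subr_eq0; apply/eqP; rewrite -linearB.
exact/vpi_gen/BalancedRel.
Qed.

Section Smash.
Variables (k : fieldType) (A : unitalAlgType k) (H : weakHopfType k).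
Variable rho : {linear tensor H A -> A}.
Implicit Types (h l m : H) (a b c : A).

Local Notation "h |> a" := (rho (h \ox a)) (at level 38, right associativity).
Local Notation P := (smash_pure rho).

Lemma lin_smashl (U : lmodType k) (f : U -> A) h :
  linear f -> linear (fun x => P (f x) h).
Proof. by move=> fl; apply: lin_fun; apply: lin_oxl. Qed.

Lemma lin_smashr (U : lmodType k) (f : U -> H) a :
  linear f -> linear (fun x => P a (f x)).
Proof. by move=> fl; apply: lin_fun; apply: lin_oxr. Qed.

Lemma smash_balanced a l h : inHL l -> P (a ** l |> 1%g) h = P a (l ** h).
Proof.
move=> lL; apply/eqP; rewrite -subr_eq0; apply/eqP; rewrite -linearB.
exact/vpi_gen/BalancedRel.
Qed.

Lemma smash_ext (U : lmodType k) (f g : smash rho -> U) :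
  linear f -> linear g -> (forall a h, f (P a h) = g (P a h)) -> f =1 g.
Proof.
move=> fl gl fg x; rewrite -[x]vreprK; move: (vrepr x); apply: tsum_ext => //.
  by apply: (lin_comp fl); exact: linearP.
by apply: (lin_comp gl); exact: linearP.
Qed.

Section Lift.
Variable (U : lmodType k).

Definition smash_lift (f : A -> H -> U) (x : smash rho) : U := tsum (vrepr x) f.

Lemma lin_smash_lift_in (V : lmodType k) (f : V -> A -> H -> U) x :
  (forall a h, linear (fun v => f v a h)) ->
  linear (fun v => smash_lift (f v) x).
Proof. exact: lin_tsum_in. Qed.

Lemma eq_smash_lift (f g : A -> H -> U) x :
  (forall a h, f a h = g a h) -> smash_lift f x = smash_lift g x.
Proof. exact: eq_tsum. Qed.

Variable f : A -> H -> U.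
Hypotheses (fl : forall h, linear (f^~ h)) (fr : forall a, linear (f a)).
Hypothesis fb : forall a l h, inHL l -> f (a ** l |> 1%g) h = f a (l ** h).

Let f0 x :
  balanced_rel (@inHL k H) (fun a l => a ** l |> 1%g) (fun l h => l ** h) x ->
  tsum x f = 0.
Proof.
case=> a l h lL; have fL := lin_tsum fl fr.
pose g : {linear tensor A H -> U} :=
  HB.pack (fun t => tsum t f) (GRing.isLinear.Build _ _ _ *:%R _ fL).
by rewrite -[LHS]/(g _) linearB /= !tsumE // fb // subrr.
Qed.

Lemma smash_liftE a h : smash_lift f (P a h) = f a h.
Proof. by rewrite /smash_lift (lin_vlift (lin_tsum fl fr) f0).1 tsumE. Qed.

Lemma lin_smash_lift : linear (smash_lift f).
Proof. exact: (lin_vlift (lin_tsum fl fr) f0).2. Qed.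

End Lift.

End Smash.

Ltac lin_ext f ::=
  lazymatch f with
  | fun _ => smash_pure _ _ ?h => apply: lin_smashl
  | fun _ => smash_pure _ ?a _ => apply: lin_smashr
  | fun _ => _ \oxR ?h => apply: lin_HRl
  | fun _ => ?h \oxR _ => apply: lin_HRr
  end.

Section SmashProduct.
Variables (k : fieldType) (A : unitalAlgType k) (H : weakHopfType k).
Variable rho : {linear tensor H A -> A}.
Variable sigma : {linear tensorHR H -> A}.
Implicit Types (h l m : H) (a b c x y : A).

Local Notation "h |> a" := (rho (h \ox a)) (at level 38, right associativity).
Local Notation P := (smash_pure rho).
Local Notation s h l := (sigma (h \oxR l)).

Definition smash_mul a h b l : smash rho :=
  \sw_(h1, h' <- h) \sw_(h2, h3 <- h') \sw_(l1, l2 <- l)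
    P (a ** h1 |> b ** s h2 l1) (h3 ** l2).

Lemma smash_mulE a h b l :
  \sw_(h1, h2, h3 <- h) \sw_(l1, l2 <- l)
    P (a ** h1 |> b ** s h2 l1) (h3 ** l2) = smash_mul a h b l.
Proof.
by apply: (@sw_coassoc _ _ _ (fun h1 h2 h3 => \sw_(l1, l2 <- l) _)); lin.
Qed.

Lemma lin_smash_mul1 (U : lmodType k) (f : U -> A) h b l :
  linear f -> linear (fun u => smash_mul (f u) h b l).
Proof. rewrite /smash_mul => fl; lin. Qed.

Lemma lin_smash_mul2 (U : lmodType k) (f : U -> H) a b l :
  linear f -> linear (fun u => smash_mul a (f u) b l).
Proof. rewrite /smash_mul => fl; lin. Qed.

Lemma lin_smash_mul3 (U : lmodType k) (f : U -> A) a h l :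
  linear f -> linear (fun u => smash_mul a h (f u) l).
Proof. rewrite /smash_mul => fl; lin. Qed.

Lemma lin_smash_mul4 (U : lmodType k) (f : U -> H) a h b :
  linear f -> linear (fun u => smash_mul a h b (f u)).
Proof. rewrite /smash_mul => fl; lin. Qed.


Definition smash_tail m a h l : smash rho :=
  \sw_(h1, h2 <- h) \sw_(l1, l2 <- l) \sw_(m1, m2 <- m)
    P (a ** s (h1 ** l1) m1) (h2 ** l2 ** m2).

Lemma lin_smash_tail1 (U : lmodType k) (f : U -> A) m h l :
  linear f -> linear (fun u => smash_tail m (f u) h l).
Proof. rewrite /smash_tail => fl; lin. Qed.

Lemma lin_smash_tail2 (U : lmodType k) (f : U -> H) m a l :
  linear f -> linear (fun u => smash_tail m a (f u) l).
Proof. rewrite /smash_tail => fl; lin. Qed.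

Lemma lin_smash_tail3 (U : lmodType k) (f : U -> H) m a h :
  linear f -> linear (fun u => smash_tail m a h (f u)).
Proof. rewrite /smash_tail => fl; lin. Qed.

Definition smash_cocycle_tail m a h l : smash rho :=
  \sw_(h1, h2 <- h) \sw_(l1, l2 <- l) smash_tail m (a ** s h1 l1) h2 l2.

End SmashProduct.


Ltac lin_ext f ::=
  lazymatch f with
  | fun _ => smash_pure _ _ ?h => apply: lin_smashl
  | fun _ => smash_pure _ ?a _ => apply: lin_smashr
  | fun _ => _ \oxR ?h => apply: lin_HRl
  | fun _ => ?h \oxR _ => apply: lin_HRr
  | fun _ => smash_mul _ _ _ ?h ?b ?l => apply: lin_smash_mul1
  | fun _ => smash_mul _ _ ?a _ ?b ?l => apply: lin_smash_mul2
  | fun _ => smash_mul _ _ ?a ?h _ ?l => apply: lin_smash_mul3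
  | fun _ => smash_mul _ _ ?a ?h ?b _ => apply: lin_smash_mul4
  | fun _ => smash_tail _ _ ?m _ ?h ?l => apply: lin_smash_tail1
  | fun _ => smash_tail _ _ ?m ?a _ ?l => apply: lin_smash_tail2
  | fun _ => smash_tail _ _ ?m ?a ?h _ => apply: lin_smash_tail3
  end.

Section SmashTheory.
Variables (k : fieldType) (A : unitalAlgType k) (H : weakHopfType k).
Variable rho : {linear tensor H A -> A}.
Variable sigma : {linear tensorHR H -> A}.
Implicit Types (h l m : H) (a b c x y : A).

Local Notation "h |> a" := (rho (h \ox a)) (at level 38, right associativity).
Local Notation P := (smash_pure rho).
Local Notation s h l := (sigma (h \oxR l)).
Local Notation mu := (smash_mul rho sigma).
Local Notation R := (smash_tail rho sigma).
Local Notation W := (smash_cocycle_tail rho sigma).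

Lemma smash_mul_balanced1 a r h b l :
  (forall h l a, inHL l -> (l ** h) |> a = l |> 1%g ** h |> a) ->
  inHL r -> mu (a ** r |> 1%g) h b l = mu a (r ** h) b l.
Proof.
move=> C3r rL; rewrite /smash_mul sw_HL_mul //; [|lin|lin].
by apply: eq_sw => h1 h'; rewrite C3r // !mulgA.
Qed.

Hypothesis C2 : forall h a b,
  h |> (a ** b) = \sw_(h1, h2 <- h) h1 |> a ** h2 |> b.

Lemma smash_mul_algr a h b c l :
  mu a h (b ** c) l = \sw_(h1, h' <- h) mu (a ** h1 |> b) h' c l.
Proof.
rewrite /smash_mul -[RHS]sw_coassoc; [|lin|lin|lin].
apply: eq_sw => y h'; rewrite C2.
have gl : linear (fun x => \sw_(h2, h3 <- h') \sw_(l1, l2 <- l)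
    P (a ** x ** s h2 l1) (h3 ** l2)) by lin.
by rewrite (sw_map _ _ gl); apply: eq_sw => h1 h2; rewrite mulgA.
Qed.

Section Associativity.

Hypothesis C8 : forall h l m,
  \sw_(h1, h2 <- h) \sw_(l1, l2 <- l) \sw_(m1, m2 <- m)
    h1 |> (s l1 m1) ** s h2 (l2 ** m2) =
  \sw_(h1, h2 <- h) \sw_(l1, l2 <- l) s h1 l1 ** s (h2 ** l2) m.
Hypothesis C9 : forall h l a,
  \sw_(h1, h2 <- h) \sw_(l1, l2 <- l) h1 |> l1 |> a ** s h2 l2 =
  \sw_(h1, h2 <- h) \sw_(l1, l2 <- l) s h1 l1 ** (h2 ** l2) |> a.

Let mu_mul a h l c m :
  mu a (h ** l) c m =
  \sw_(h1, h' <- h) \sw_(l1, l' <- l) R m (a ** (h1 ** l1) |> c) h' l'.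
Proof.
rewrite /smash_mul [LHS]sw_mul; [|lin|lin].
apply: eq_sw => h1 h'; apply: eq_sw => l1 l'.
by rewrite [LHS]sw_mul //; lin.
Qed.

Let mu_cocycle_mul a h l c m :
  \sw_(h1, h2 <- h) \sw_(l1, l2 <- l) mu (a ** s h1 l1) (h2 ** l2) c m =
  \sw_(h1, h' <- h) \sw_(l1, l' <- l) W m (a ** h1 |> l1 |> c) h' l'.
Proof.
transitivity (\sw_(h1, h' <- h) \sw_(l1, l' <- l)
    \sw_(h2, h3 <- h') \sw_(l2, l3 <- l')
    R m (a ** (s h1 l1 ** (h2 ** l2) |> c)) h3 l3).
  apply: eq_sw => h1 h'; apply: eq_sw => l1 l'; rewrite mu_mul.
  by apply: eq_sw => h2 h3; apply: eq_sw => l2 l3; rewrite mulgA.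
rewrite -[LHS](sw2_coassoc (f := fun h1 h2 h3 l1 l2 l3 =>
  R m (a ** (s h1 l1 ** (h2 ** l2) |> c)) h3 l3)); [|lin|lin|lin|lin|lin|lin].
transitivity (\sw_(h1, h' <- h) \sw_(l1, l' <- l)
    \sw_(h2, h3 <- h') \sw_(l2, l3 <- l')
    R m (a ** (h1 |> l1 |> c ** s h2 l2)) h3 l3); last first.
  apply: eq_sw => h1 h'; apply: eq_sw => l1 l'.
  by apply: eq_sw => h2 h3; apply: eq_sw => l2 l3; rewrite mulgA.
rewrite -[RHS](sw2_coassoc (f := fun h1 h2 h3 l1 l2 l3 =>
  R m (a ** (h1 |> l1 |> c ** s h2 l2)) h3 l3)); [|lin|lin|lin|lin|lin|lin].
apply: eq_sw => y h3; apply: eq_sw => z l3.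
have gl : linear (fun x => R m (a ** x) h3 l3) by lin.
transitivity (R m (a ** \sw_(h1, h2 <- y) \sw_(l1, l2 <- z)
    h1 |> l1 |> c ** s h2 l2) h3 l3).
  rewrite C9 (sw_map _ _ gl).
  by apply: eq_sw => h1 h2; rewrite (sw_map _ _ gl).
rewrite (sw_map _ _ gl).
by apply: eq_sw => h1 h2; rewrite (sw_map _ _ gl).
Qed.

Let mu_cocycle_right a h l m :
  \sw_(l1, l2 <- l) \sw_(m1, m2 <- m) mu a h (s l1 m1) (l2 ** m2) = W m a h l.
Proof.
transitivity (\sw_(l1, l' <- l) \sw_(m1, m' <- m) \sw_(l2, l3 <- l')
    \sw_(m2, m3 <- m') \sw_(h1, h' <- h) \sw_(h2, h3 <- h')
    P (a ** (h1 |> s l1 m1 ** s h2 (l2 ** m2))) (h3 ** l3 ** m3)).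
  apply: eq_sw => l1 l'; apply: eq_sw => m1 m'; rewrite /smash_mul.
  transitivity (\sw_(h1, h' <- h) \sw_(h2, h3 <- h')
      \sw_(l2, l3 <- l') \sw_(m2, m3 <- m')
      P (a ** (h1 |> s l1 m1 ** s h2 (l2 ** m2))) (h3 ** l3 ** m3)).
    apply: eq_sw => h1 h'; apply: eq_sw => h2 h3; rewrite sw_mul; [|lin|lin].
    by apply: eq_sw => l2 l3; apply: eq_sw => m2 m3; rewrite !mulgA.
  transitivity (\sw_(h1, h' <- h) \sw_(l2, l3 <- l') \sw_(m2, m3 <- m')
      \sw_(h2, h3 <- h')
      P (a ** (h1 |> s l1 m1 ** s h2 (l2 ** m2))) (h3 ** l3 ** m3)).
    apply: eq_sw => h1 h'; rewrite sw_exch; apply: eq_sw => l2 l3.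
    by rewrite sw_exch.
  by rewrite sw_exch; apply: eq_sw => l2 l3; rewrite sw_exch.
rewrite -[LHS]sw2_coassoc; [|lin|lin|lin|lin|lin|lin].
transitivity (\sw_(h', h3 <- h) \sw_(l', l3 <- l) \sw_(m', m3 <- m)
    P (a ** \sw_(h1, h2 <- h') \sw_(l1, l2 <- l') \sw_(m1, m2 <- m')
      h1 |> s l1 m1 ** s h2 (l2 ** m2)) (h3 ** l3 ** m3)).
  rewrite [RHS]sw_exch; apply: eq_sw => l' l3.
  rewrite [RHS]sw_exch; apply: eq_sw => m' m3.
  transitivity (\sw_(l1, l2 <- l') \sw_(m1, m2 <- m') \sw_(h', h3 <- h)
      \sw_(h1, h2 <- h')
      P (a ** (h1 |> s l1 m1 ** s h2 (l2 ** m2))) (h3 ** l3 ** m3)).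
    apply: eq_sw => l1 l2; apply: eq_sw => m1 m2.
    by rewrite sw_coassoc //; lin.
  transitivity (\sw_(h', h3 <- h) \sw_(l1, l2 <- l') \sw_(m1, m2 <- m')
      \sw_(h1, h2 <- h')
      P (a ** (h1 |> s l1 m1 ** s h2 (l2 ** m2))) (h3 ** l3 ** m3)).
    by rewrite [RHS]sw_exch; apply: eq_sw => l1 l2; rewrite [RHS]sw_exch.
  apply: eq_sw => h' h3.
  have Pl : linear (fun x => P (a ** x) (h3 ** l3 ** m3)) by lin.
  rewrite (sw_map _ _ Pl).
  transitivity (\sw_(h1, h2 <- h') \sw_(l1, l2 <- l') \sw_(m1, m2 <- m')
      P (a ** (h1 |> s l1 m1 ** s h2 (l2 ** m2))) (h3 ** l3 ** m3)).
    by rewrite [RHS]sw_exch; apply: eq_sw => l1 l2; rewrite [RHS]sw_exch.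
  apply: eq_sw => h1 h2; rewrite (sw_map _ _ Pl); apply: eq_sw => l1 l2.
  by rewrite (sw_map _ _ Pl).
rewrite /smash_cocycle_tail /smash_tail.
transitivity (\sw_(h1, h' <- h) \sw_(l1, l' <- l) \sw_(h2, h3 <- h')
    \sw_(l2, l3 <- l') \sw_(m1, m3 <- m)
    P (a ** (s h1 l1 ** s (h2 ** l2) m1)) (h3 ** l3 ** m3)); last first.
  apply: eq_sw => h1 h'; apply: eq_sw => l1 l'.
  apply: eq_sw => h2 h3; apply: eq_sw => l2 l3.
  by apply: eq_sw => m1 m3; rewrite !mulgA.
rewrite -[RHS]sw2_coassoc; [|lin|lin|lin|lin|lin|lin].
apply: eq_sw => h' h3; apply: eq_sw => l' l3.
transitivity (\sw_(m', m3 <- m) \sw_(h1, h2 <- h') \sw_(l1, l2 <- l')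
    P (a ** (s h1 l1 ** s (h2 ** l2) m')) (h3 ** l3 ** m3)).
  apply: eq_sw => m' m3; rewrite C8.
  have Pl : linear (fun x => P (a ** x) (h3 ** l3 ** m3)) by lin.
  rewrite (sw_map _ _ Pl); apply: eq_sw => h1 h2.
  by rewrite (sw_map _ _ Pl).
by rewrite [LHS]sw_exch; apply: eq_sw => h1 h2; rewrite [LHS]sw_exch.
Qed.

Lemma smash_mul_assoc a h b l c m :
  \sw_(h1, h' <- h) \sw_(h2, h3 <- h') \sw_(l1, l2 <- l)
    mu (a ** h1 |> b ** s h2 l1) (h3 ** l2) c m =
  \sw_(l1, l' <- l) \sw_(l2, l3 <- l') \sw_(m1, m2 <- m)
    mu a h (b ** l1 |> c ** s l2 m1) (l3 ** m2).
Proof.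
transitivity (\sw_(h1, h' <- h) \sw_(h2, h'' <- h') \sw_(l1, l' <- l)
    W m (a ** h1 |> b ** h2 |> l1 |> c) h'' l').
  by apply: eq_sw => h1 h'; rewrite mu_cocycle_mul.
transitivity (\sw_(l1, l' <- l) \sw_(h1, h' <- h) \sw_(h2, h'' <- h')
    W m (a ** h1 |> b ** h2 |> l1 |> c) h'' l').
  by rewrite [RHS]sw_exch; apply: eq_sw => h1 h'; rewrite [RHS]sw_exch.
apply: eq_sw => l1 l'.
transitivity (\sw_(l2, l3 <- l') \sw_(m1, m2 <- m)
    \sw_(h1, h' <- h) \sw_(h2, h'' <- h')
    mu (a ** h1 |> b ** h2 |> l1 |> c) h'' (s l2 m1) (l3 ** m2)); last first.
  apply: eq_sw => l2 l3; apply: eq_sw => m1 m2; rewrite -mulgA smash_mul_algr.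
  by apply: eq_sw => h1 h'; rewrite smash_mul_algr.
transitivity (\sw_(h1, h' <- h) \sw_(h2, h'' <- h')
    \sw_(l2, l3 <- l') \sw_(m1, m2 <- m)
    mu (a ** h1 |> b ** h2 |> l1 |> c) h'' (s l2 m1) (l3 ** m2)).
  apply: eq_sw => h1 h'; apply: eq_sw => h2 h''.
  by rewrite mu_cocycle_right.
transitivity (\sw_(h1, h' <- h) \sw_(l2, l3 <- l') \sw_(m1, m2 <- m)
    \sw_(h2, h'' <- h')
    mu (a ** h1 |> b ** h2 |> l1 |> c) h'' (s l2 m1) (l3 ** m2)).
  apply: eq_sw => h1 h'; rewrite sw_exch; apply: eq_sw => l2 l3.
  by rewrite sw_exch.
by rewrite sw_exch; apply: eq_sw => l2 l3; rewrite sw_exch.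
Qed.

End Associativity.

End SmashTheory.

Section SmashAlgebra.
Variables (k : fieldType) (A : unitalAlgType k) (H : weakHopfType k).
Variable rho : {linear tensor H A -> A}.
Variable sigma : {linear tensorHR H -> A}.
Implicit Types (h l m : H) (a b c : A).

Local Notation "h |> a" := (rho (h \ox a)) (at level 38, right associativity).
Local Notation P := (smash_pure rho).
Local Notation s h l := (sigma (h \oxR l)).
Local Notation mu := (smash_mul rho sigma).

Hypothesis C1 : forall h, h |> 1%g = PiL h |> 1%g.

Lemma smash_nabla a h : \sw_(h1, h2 <- h) P (a ** h1 |> 1%g) h2 = P a h.
Proof.
have Pl : linear (fun l => P a l) by lin.
rewrite -[in RHS](PiL_mul h) (sw_map _ _ Pl).
by apply: eq_sw => h1 h2; rewrite C1 smash_balanced //; exists h1.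
Qed.

Hypothesis C2 : forall h a b,
  h |> (a ** b) = \sw_(h1, h2 <- h) h1 |> a ** h2 |> b.
Hypothesis C4 : forall a, (1%g : H) |> a = a.
Hypothesis C5l : forall h h' l, inHL l -> s (l ** h) h' = l |> 1%g ** s h h'.
Hypothesis C6 : forall h h' l, inHL l ->
  \sw_(h1, h2 <- h) h1 |> l |> 1%g ** s h2 h' = s h (l ** h').
Hypothesis C7l : forall h, s 1%g h = h |> 1%g.
Hypothesis C7r : forall h, s h 1%g = h |> 1%g.

Let mu_unitr a h r l : inHL r ->
  mu a h (r |> 1%g) l =
  \sw_(h1, h2 <- h) \sw_(l1, l2 <- l) P (a ** s h1 (r ** l1)) (h2 ** l2).
Proof.
move=> rL; rewrite /smash_mul -[LHS]sw_coassoc; [|lin|lin|lin].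
apply: eq_sw => y h3; rewrite [LHS]sw_exch; apply: eq_sw => l1 l2.
have Pl : linear (fun x => P (a ** x) (h3 ** l2)) by lin.
rewrite -C6 // (sw_map _ _ Pl).
by apply: eq_sw => h1 h2; rewrite mulgA.
Qed.

Lemma smash_mul_balanced2 a h b r l :
  inHL r -> mu a h (b ** r |> 1%g) l = mu a h b (r ** l).
Proof.
move=> rL; rewrite smash_mul_algr // [in RHS]/smash_mul.
apply: eq_sw => h1 h'; rewrite mu_unitr //.
by apply: eq_sw => h2 h3; rewrite [RHS]sw_HL_mul //; lin.
Qed.

Lemma smash_mul_1l b l : mu 1%g 1%g b l = P b l.
Proof.
rewrite /smash_mul [LHS]sw_unitl; [|lin|lin|lin].
transitivity (\sw_(x1, x2 <- (1%g : H)) \sw_(y1, y2 <- (1%g : H))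
    \sw_(l1, l2 <- l) P (x1 |> b ** x2 |> 1%g ** s y1 l1) (y2 ** l2)).
  rewrite -[LHS]sw1_PiL; [|lin|lin].
  rewrite -[RHS]sw1_PiL; [|lin|lin].
  apply: eq_sw => x1 x2; apply: eq_sw => y1 y2; apply: eq_sw => l1 l2.
  by rewrite mul1g C5l ?mulgA //; exists x2.
rewrite [LHS]sw_exch.
transitivity (\sw_(y1, y2 <- (1%g : H)) \sw_(l1, l2 <- l)
    P (b ** (y1 ** l1) |> 1%g) (y2 ** l2)); last first.
  by rewrite -[RHS]smash_nabla -[RHS]sw1_mull; [|lin|lin].
transitivity (\sw_(y1, y2 <- (1%g : H)) \sw_(l1, l2 <- l)
    P (b ** s y1 l1) (y2 ** l2)).
  apply: eq_sw => y1 y2; rewrite [LHS]sw_exch; apply: eq_sw => l1 l2.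
  have Pl : linear (fun x => P (x ** s y1 l1) (y2 ** l2)) by lin.
  by rewrite -(sw_map _ _ Pl) -C2 mulg1 C4.
rewrite -[LHS]sw1_PiR; [|lin|lin].
rewrite -[RHS]sw1_PiR; [|lin|lin].
apply: eq_sw => y1 y2; apply: eq_sw => l1 l2.
by rewrite -[PiR y1]mul1g oxR_balanced ?C7l ?mul1g //; exists y1.
Qed.

Lemma smash_mul_1r a h : mu a h 1%g 1%g = P a h.
Proof.
have -> : mu a h 1%g 1%g = mu a h (1%g |> 1%g) 1%g by rewrite C4.
rewrite mu_unitr; last exact: inHL1.
transitivity (\sw_(h1, h2 <- h) \sw_(x1, x2 <- (1%g : H))
    P (a ** (h1 ** x1) |> 1%g) (h2 ** x2)); last first.
  by rewrite -[RHS]smash_nabla -[RHS]sw1_mulr; [|lin|lin].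
apply: eq_sw => h1 h2.
rewrite -[LHS]sw1_PiR; [|lin|lin].
rewrite -[RHS]sw1_PiR; [|lin|lin].
apply: eq_sw => x1 x2.
by rewrite mul1g -[in LHS](mulg1 (PiR x1)) -oxR_balanced ?C7r //; exists x1.
Qed.

Hypothesis C3r : forall h l a, inHL l -> (l ** h) |> a = l |> 1%g ** h |> a.
Hypothesis C8 : forall h l m,
  \sw_(h1, h2 <- h) \sw_(l1, l2 <- l) \sw_(m1, m2 <- m)
    h1 |> (s l1 m1) ** s h2 (l2 ** m2) =
  \sw_(h1, h2 <- h) \sw_(l1, l2 <- l) s h1 l1 ** s (h2 ** l2) m.
Hypothesis C9 : forall h l a,
  \sw_(h1, h2 <- h) \sw_(l1, l2 <- l) h1 |> l1 |> a ** s h2 l2 =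
  \sw_(h1, h2 <- h) \sw_(l1, l2 <- l) s h1 l1 ** (h2 ** l2) |> a.

Let act a (x : smash rho) := smash_lift (fun b h => P (a ** b) h) x.
Let mul (x y : smash rho) :=
  smash_lift (fun a h => smash_lift (fun b l => mu a h b l) y) x.
Let coact (x : smash rho) : tensor (smash rho) H :=
  smash_lift (fun a h => \sw_(h1, h2 <- h) (P a h1 \ox h2)) x.

Let actE a b h : act a (P b h) = P (a ** b) h.
Proof.
rewrite /act smash_liftE //; [lin|lin|] => {}b l {}h lL.
by rewrite mulgA smash_balanced.
Qed.

Let act_lin a : linear (act a).
Proof.
apply: lin_smash_lift; [lin|lin|] => b l h lL.
by rewrite mulgA smash_balanced.
Qed.

Let mulE a h b l : mul (P a h) (P b l) = mu a h b l.
Proof.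
have E a' h' : smash_lift (fun b l => mu a' h' b l) (P b l) = mu a' h' b l.
  by rewrite smash_liftE; [|lin|lin|move=> *; exact: smash_mul_balanced2].
rewrite /mul smash_liftE ?E //.
- by move=> h'; apply: lin_smash_lift_in => *; lin.
- by move=> a'; apply: lin_smash_lift_in => *; lin.
move=> a' r h' rL; apply: eq_smash_lift => b' l'.
exact: smash_mul_balanced1.
Qed.

Let mul_linl y : linear (mul^~ y).
Proof.
apply: lin_smash_lift.
- by move=> h'; apply: lin_smash_lift_in => *; lin.
- by move=> a'; apply: lin_smash_lift_in => *; lin.
move=> a' r h' rL; apply: eq_smash_lift => b' l'.
exact: smash_mul_balanced1.
Qed.

Let mul_linr x : linear (mul x).
Proof.
apply: lin_smash_lift_in => a h; apply: lin_smash_lift; [lin|lin|].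
move=> *; exact: smash_mul_balanced2.
Qed.

Let coact_lin : linear coact.
Proof.
apply: lin_smash_lift; [lin|lin|] => a l h lL; rewrite sw_HL_mul //; [|lin|lin].
by apply: eq_sw => h1 h2; rewrite smash_balanced.
Qed.

Let coactE a h : coact (P a h) = \sw_(h1, h2 <- h) (P a h1 \ox h2).
Proof.
rewrite /coact smash_liftE //; [lin|lin|] => {}a l {}h lL.
rewrite sw_HL_mul //; [|lin|lin].
by apply: eq_sw => h1 h2; rewrite smash_balanced.
Qed.

Let tsum_coact (U : lmodType k) (G : smash rho -> H -> U) a h :
  bilinear_map G ->
  \tsum_(y, h2 <- coact (P a h)) G y h2 = \sw_(h1, h2 <- h) G (P a h1) h2.
Proof.
move=> Gb; rewrite coactE.
have Gl : linear (fun t : tensor (smash rho) H => tsum t G).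
  exact: tsum_is_linear.
by rewrite (sw_map _ _ Gl); apply: eq_sw => h1 h2; rewrite tsumE.
Qed.

Let mul_map (U : lmodType k) (f : smash rho -> U) a h b l : linear f ->
  f (mu a h b l) =
  \sw_(h1, h' <- h) \sw_(h2, h3 <- h') \sw_(l1, l2 <- l)
    f (P (a ** h1 |> b ** s h2 l1) (h3 ** l2)).
Proof.
move=> fl; rewrite /smash_mul (sw_map _ _ fl); apply: eq_sw => h1 h'.
by rewrite (sw_map _ _ fl); apply: eq_sw => h2 h3; rewrite (sw_map _ _ fl).
Qed.

Lemma smash_crossed_product :
  crossed_product rho (fun h h' => sigma (h \oxR h')) (smash_pure rho).
Proof.
apply: (@CrossedProduct _ _ _ _ _ _ _ act mul (P 1%g 1%g) coact).
- split=> [x|a]; last exact: act_lin.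
  by apply: lin_smash_lift_in => *; lin.
- exact: actE.
- apply: smash_ext => [||a h]; [exact: act_lin|exact: lin_id|].
  by rewrite actE mul1g.
- move=> a b; apply: smash_ext => [||c h]; last by rewrite !actE mulgA.
    by apply: (lin_comp (act_lin a)).
  exact: act_lin.
- by split=> [y|x]; [exact: mul_linl|exact: mul_linr].
- by move=> a h b l; rewrite mulE -smash_mulE.
- move=> x y z; move: x; apply: smash_ext => [||a h].
  + exact: mul_linl.
  + exact: (lin_comp (mul_linl z) (mul_linl y)).
  move: y; apply: smash_ext => [||b l].
  + exact: (lin_comp (mul_linr _) (mul_linl z)).
  + exact: (lin_comp (mul_linl z) (mul_linr _)).
  move: z; apply: smash_ext => [||c m].
  + exact: (lin_comp (mul_linr _) (mul_linr _)).
  + exact: mul_linr.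
  rewrite !mulE (mul_map _ _ _ _ (mul_linr _)) (mul_map _ _ _ _ (mul_linl _)).
  transitivity (\sw_(l1, l' <- l) \sw_(l2, l3 <- l') \sw_(m1, m2 <- m)
      mu a h (b ** l1 |> c ** s l2 m1) (l3 ** m2)).
    apply: eq_sw => l1 l'; apply: eq_sw => l2 l3; apply: eq_sw => m1 m2.
    by rewrite mulE.
  rewrite -smash_mul_assoc //.
  apply: eq_sw => h1 h'; apply: eq_sw => h2 h3; apply: eq_sw => l1 l2.
  by rewrite mulE.
- by [].
- apply: smash_ext => [||b l]; [exact: mul_linr|exact: lin_id|].
  by rewrite mulE smash_mul_1l.
- apply: smash_ext => [||a h]; [exact: mul_linl|exact: lin_id|].
  by rewrite mulE smash_mul_1r.
- exact: coact_lin.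
- exact: coactE.
- have Gb h2 : bilinear_map (fun (z : smash rho) (h1 : H) => z \ox (h1 \ox h2)).
    by split=> [w|v]; lin.
  have Gb2 : bilinear_map (fun (y : smash rho) (h2 : H) =>
      \tsum_(z, h1 <- coact y) (z \ox (h1 \ox h2))).
    split=> [h2|y]; last by apply: lin_tsum_in => *; lin.
    exact: (lin_comp (tsum_is_linear (Gb h2)) coact_lin).
  have Gb3 : bilinear_map (fun (y : smash rho) (h : H) =>
      \sw_(h1, h2 <- h) (y \ox (h1 \ox h2))) by split=> *; lin.
  apply: smash_ext => [||a h].
  + exact: (lin_comp (tsum_is_linear Gb2) coact_lin).
  + exact: (lin_comp (tsum_is_linear Gb3) coact_lin).
  rewrite !tsum_coact // -[RHS]sw_coassoc; [|lin|lin|lin].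
  by apply: eq_sw => y h3; rewrite tsum_coact.
- have Gb : bilinear_map (fun (y : smash rho) (h : H) => (counit h : k) *: y).
    by split=> *; lin.
  apply: smash_ext => [||a h]; last by rewrite tsum_coact // sw_counitr //; lin.
    exact: (lin_comp (tsum_is_linear Gb) coact_lin).
  exact: lin_id.
Qed.

End SmashAlgebra.

Section Transport.
Variables (k : fieldType) (A : unitalAlgType k) (H : weakHopfType k).
Variables (rho : {linear tensor H A -> A}) (cocycle : H -> H -> A).
Variables (X Y : lmodType k) (pureX : A -> H -> X) (pureY : A -> H -> Y).
Variables (f : X -> Y).
Hypotheses (fl : linear f) (f_pure : forall a h, f (pureX a h) = pureY a h).

Lemma crossed_product_transport (g : Y -> X) :
  linear g -> cancel f g -> cancel g f ->
  crossed_product rho cocycle pureX -> crossed_product rho cocycle pureY.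
Proof.
move=> gl fK gK P.
have g_pure a h : g (pureY a h) = pureX a h by rewrite -f_pure fK.
have foxl (h : H) : linear (fun x => f x \ox h) by exact: lin_oxl.
have foxr x : linear (fun h : H => f x \ox h) by exact/lin_oxr/lin_id.
pose coact y : tensor Y H := \tsum_(x, h <- cp_coact P (g y)) (f x \ox h).
have coact_lin : linear coact.
  apply: (lin_comp (lin_tsum foxl foxr)).
  exact: (lin_comp (cp_coact_linear P) gl).
have tsum_coact (U : lmodType k) (G : Y -> H -> U) y : bilinear_map G ->
    \tsum_(z, h <- coact y) G z h = \tsum_(x, h <- cp_coact P (g y)) G (f x) h.
  move=> Gb; rewrite (tsum_map _ _ (tsum_is_linear Gb)).
  by apply: eq_tsum => x h; rewrite tsumE.
have coactA y :
    \tsum_(z, h2 <- coact y) \tsum_(z', h1 <- coact z) (z' \ox (h1 \ox h2)) =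
    \tsum_(z, h <- coact y) \sw_(h1, h2 <- h) (z \ox (h1 \ox h2)).
  have Gb h2 : bilinear_map (fun (z : Y) (h1 : H) => z \ox (h1 \ox h2)).
    by split=> *; lin.
  have Gb2 : bilinear_map (fun (y : Y) (h2 : H) =>
      \tsum_(z, h1 <- coact y) (z \ox (h1 \ox h2))).
    split=> [h2|z]; last by apply: lin_tsum_in => *; lin.
    apply: (lin_comp (g := fun t : tensor Y H =>
      \tsum_(z, h1 <- t) (z \ox (h1 \ox h2)))) => //.
    exact: tsum_is_linear.
  have Gb3 : bilinear_map (fun (y : Y) (h : H) =>
      \sw_(h1, h2 <- h) (y \ox (h1 \ox h2))) by split=> *; lin.
  rewrite !tsum_coact //.
  have Fb : bilinear_map (fun (x : X) (w : tensor H H) => f x \ox w).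
    by split=> *; lin.
  have Fl := tsum_is_linear Fb.
  have := congr1 (fun t => tsum t (fun (x : X) (w : tensor H H) => f x \ox w))
    (cp_coactA P (g y)).
  rewrite !(tsum_map _ _ Fl) => E.
  transitivity (\tsum_(x, h2 <- cp_coact P (g y))
      tsum (\tsum_(z, h1 <- cp_coact P x) (z \ox (h1 \ox h2)))
      (fun (x : X) (w : tensor H H) => f x \ox w)).
    apply: eq_tsum => x h2; rewrite tsum_coact // fK (tsum_map _ _ Fl).
    by apply: eq_tsum => z h1; rewrite tsumE.
  rewrite E; apply: eq_tsum => x h; rewrite (sw_map _ _ Fl).
  by apply: eq_sw => h1 h2; rewrite tsumE.
have [actl actr] := cp_act_bilinear P.
have [mull mulr] := cp_mul_bilinear P.
apply: (@CrossedProduct _ _ _ _ _ _ _ (fun a y => f (cp_act P a (g y)))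
  (fun y z => f (cp_mul P (g y) (g z))) (f (cp_one P)) coact).
- split=> [y|a]; first exact: (lin_comp fl (actl (g y))).
  exact: (lin_comp fl (lin_comp (actr a) gl)).
- by move=> a b h; rewrite g_pure cp_actE.
- by move=> y; rewrite cp_act1 gK.
- by move=> a b y; rewrite fK cp_actA.
- split=> [z|y]; first exact: (lin_comp fl (lin_comp (mull (g z)) gl)).
  exact: (lin_comp fl (lin_comp (mulr (g y)) gl)).
- move=> a h b l; rewrite !g_pure cp_mulE (tsum_map _ _ fl).
  apply: eq_tsum => h' h3; rewrite (tsum_map _ _ fl).
  apply: eq_tsum => h1 h2; rewrite (sw_map _ _ fl).
  by apply: eq_sw => l1 l2.
- by move=> x y z; rewrite !fK cp_mulA.
- by rewrite cp_oneE.
- by move=> y; rewrite fK cp_mul1.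
- by move=> y; rewrite fK cp_mulr1.
- exact: coact_lin.
- move=> a h; rewrite /coact g_pure cp_coactE.
  rewrite (sw_map _ _ (lin_tsum foxl foxr)); apply: eq_sw => h1 h2.
  by rewrite tsumE ?f_pure.
- exact: coactA.
- move=> y; have Gb : bilinear_map (fun (z : Y) (h : H) => (counit h : k) *: z).
    by split=> *; lin.
  rewrite (tsum_coact _ _ _ Gb) -[RHS]gK -[in RHS](cp_counit P (g y)).
  rewrite (tsum_map _ _ fl).
  by apply: eq_tsum => x h; rewrite (linZ _ _ fl).
Qed.

Hypothesis extX : forall (U : lmodType k) (u v : X -> U),
  linear u -> linear v -> (forall a h, u (pureX a h) = v (pureX a h)) -> u =1 v.

Lemma crossed_iso_pure (P : crossed_product rho cocycle pureX)
    (Q : crossed_product rho cocycle pureY) : bijective f -> crossed_iso P Q f.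
Proof.
move=> f_bij.
have [actl actr] := cp_act_bilinear P.
have [mull mulr] := cp_mul_bilinear P.
have [actl' actr'] := cp_act_bilinear Q.
have [mull' mulr'] := cp_mul_bilinear Q.
split=> //.
- move=> x y; move: x; apply: extX => [||a h].
  + exact: (lin_comp fl (mull y)).
  + exact: (lin_comp (mull' (f y)) fl).
  move: y; apply: extX => [||b l].
  + exact: (lin_comp fl (mulr _)).
  + exact: (lin_comp (mulr' _) fl).
  rewrite !f_pure !cp_mulE (tsum_map _ _ fl); apply: eq_tsum => h' h3.
  rewrite (tsum_map _ _ fl); apply: eq_tsum => h1 h2.
  by rewrite (sw_map _ _ fl); apply: eq_sw => l1 l2.
- by rewrite !cp_oneE.
- move=> a; apply: extX => [||b h].
  + exact: (lin_comp fl (actr a)).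
  + exact: (lin_comp (actr' a) fl).
  by rewrite f_pure !cp_actE f_pure.
- have foxl (h : H) : linear (fun x => f x \ox h) by exact: lin_oxl.
  have foxr x : linear (fun h : H => f x \ox h) by exact/lin_oxr/lin_id.
  apply: extX => [||a h].
  + exact: (lin_comp (cp_coact_linear Q) fl).
  + exact: (lin_comp (lin_tsum foxl foxr) (cp_coact_linear P)).
  rewrite f_pure !cp_coactE (sw_map _ _ (lin_tsum foxl foxr)).
  by apply: eq_sw => h1 h2; rewrite tsumE ?f_pure.
Qed.

End Transport.

Section Times.
Variables (k : fieldType) (A : unitalAlgType k) (H : weakHopfType k).
Variable rho : {linear tensor H A -> A}.
Implicit Types (h l m : H) (a b c : A).

Local Notation "h |> a" := (rho (h \ox a)) (at level 38, right associativity).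

Let to_times (t : tensor A H) : times rho := Times (in_nablaP rho t).

Let lin_to_times : linear to_times.
Proof. by move=> c t u; apply: val_inj; rewrite linearP /= linearP. Qed.

Lemma times_ext (U : lmodType k) (f g : times rho -> U) :
  linear f -> linear g ->
  (forall a h, f (times_pure rho a h) = g (times_pure rho a h)) -> f =1 g.
Proof.
move=> fl gl fg x; have /asboolP[t xE] := valP x.
have -> : x = to_times t by exact: val_inj.
move: {x xE} t; apply: tsum_ext => //.
  exact: (lin_comp fl).
exact: (lin_comp gl).
Qed.

Lemma lin_times_purel h : linear (fun a => times_pure rho a h).
Proof. exact/(lin_comp lin_to_times)/lin_oxl/lin_id. Qed.

Lemma lin_times_purer a : linear (fun h => times_pure rho a h).
Proof. exact/(lin_comp lin_to_times)/lin_oxr/lin_id. Qed.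

Lemma nabla_pure a h :
  nabla rho (a \ox h) = \sw_(h1, h2 <- h) ((a ** h1 |> 1%g) \ox h2).
Proof. by rewrite /nabla tsumE //; exact: nabla_bilinear. Qed.

Hypothesis C1 : forall h, h |> 1%g = PiL h |> 1%g.
Hypothesis C3r : forall h l a, inHL l -> (l ** h) |> a = l |> 1%g ** h |> a.

Lemma times_balanced a l h : inHL l ->
  times_pure rho (a ** l |> 1%g) h = times_pure rho a (l ** h).
Proof.
move=> lL; apply: val_inj; rewrite /= !nabla_pure sw_HL_mul //; [|lin|lin].
by apply: eq_sw => h1 h2; rewrite C3r // mulgA.
Qed.

Lemma psi_linear : linear (@psi _ _ _ rho).
Proof. by move=> c x y; rewrite /psi -linearP. Qed.

Lemma psi_pure a h : psi (times_pure rho a h) = smash_pure rho a h.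
Proof.
rewrite /psi /= nabla_pure (sw_map (g := @smash_pi _ _ _ rho)) //.
  exact: smash_nabla.
exact: linearP.
Qed.

Definition smash_to_times : smash rho -> times rho :=
  smash_lift (@times_pure _ _ _ rho).

Lemma smash_to_times_linear : linear smash_to_times.
Proof.
exact: (lin_smash_lift lin_times_purel lin_times_purer times_balanced).
Qed.

Lemma smash_to_times_pure a h :
  smash_to_times (smash_pure rho a h) = times_pure rho a h.
Proof. exact: (smash_liftE lin_times_purel lin_times_purer times_balanced). Qed.

Lemma psiK : cancel (@psi _ _ _ rho) smash_to_times.
Proof.
apply: times_ext => [||a h].
- exact: (lin_comp smash_to_times_linear psi_linear).
- exact: lin_id.
by rewrite psi_pure smash_to_times_pure.
Qed.

Lemma smash_to_timesK : cancel smash_to_times (@psi _ _ _ rho).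
Proof.
apply: smash_ext => [||a h].
- exact: (lin_comp psi_linear smash_to_times_linear).
- exact: lin_id.
by rewrite smash_to_times_pure psi_pure.
Qed.

End Times.

Theorem proposition2p8 (k : fieldType) (A : unitalAlgType k) (H : weakHopfType k)
    (Sinv : H -> H) (SK : cancel (antipode : H -> H) Sinv)
    (SinvK : cancel Sinv (antipode : H -> H))
    (rho : {linear tensor H A -> A}) (sigma : {linear tensorHR H -> A})
    (C1 : forall h : H, rho (h \ox 1%g) = rho (PiL h \ox 1%g))
    (C2 : forall (h : H) (a a' : A),
      rho (h \ox (a ** a')) =
      \sw_(h1, h2 <- h) rho (h1 \ox a) ** rho (h2 \ox a'))
    (C3l : forall (h l : H) (a : A), inHL l ->
      rho ((Sinv l ** h) \ox a) = rho (h \ox a) ** rho (l \ox 1%g))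
    (C3r : forall (h l : H) (a : A), inHL l ->
      rho ((l ** h) \ox a) = rho (l \ox 1%g) ** rho (h \ox a))
    (C4 : forall a : A, rho ((1%g : H) \ox a) = a)
    (C5l : forall h h' l : H, inHL l ->
      sigma ((l ** h) \oxR h') = rho (l \ox 1%g) ** sigma (h \oxR h'))
    (C5r : forall h h' l : H, inHL l ->
      sigma ((Sinv l ** h) \oxR h') = sigma (h \oxR h') ** rho (l \ox 1%g))
    (C6 : forall h h' l : H, inHL l ->
      \sw_(h1, h2 <- h) rho (h1 \ox rho (l \ox 1%g)) ** sigma (h2 \oxR h') =
      sigma (h \oxR (l ** h')))
    (C7l : forall h : H, sigma (1%g \oxR h) = rho (h \ox 1%g))
    (C7r : forall h : H, sigma (h \oxR 1%g) = rho (h \ox 1%g))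
    (C8 : forall h h' m : H,
      \sw_(h1, h2 <- h) \sw_(k1, k2 <- h') \sw_(m1, m2 <- m)
        rho (h1 \ox sigma (k1 \oxR m1)) ** sigma (h2 \oxR (k2 ** m2)) =
      \sw_(h1, h2 <- h) \sw_(k1, k2 <- h')
        sigma (h1 \oxR k1) ** sigma ((h2 ** k2) \oxR m))
    (C9 : forall (h h' : H) (a : A),
      \sw_(h1, h2 <- h) \sw_(k1, k2 <- h')
        rho (h1 \ox rho (k1 \ox a)) ** sigma (h2 \oxR k2) =
      \sw_(h1, h2 <- h) \sw_(k1, k2 <- h')
        sigma (h1 \oxR k1) ** rho ((h2 ** k2) \ox a))
    (C10 : forall h l : H, inHL l ->
      rho (h \ox rho (l \ox 1%g)) = rho ((h ** l) \ox 1%g)) :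
  let timesAlg := crossed_product rho
    (fun h h' => varsigma sigma (h \ox h')) (times_pure rho) in
  let smashAlg := crossed_product rho
    (fun h h' => sigma (h \oxR h')) (smash_pure rho) in
  inhabited timesAlg /\ inhabited smashAlg /\
  forall (P : timesAlg) (Q : smashAlg), crossed_iso P Q (@psi _ _ _ rho).
Proof.
move=> timesAlg smashAlg.
have Q : smashAlg by exact: smash_crossed_product.
have P : timesAlg.
  apply: (crossed_product_transport (f := @smash_to_times _ _ _ rho)
    _ _ _ _ _ Q).
  - exact: smash_to_times_linear.
  - exact: smash_to_times_pure.
  - exact: psi_linear.
  - exact: smash_to_timesK.
  - exact: psiK.
do 2!split=> //; move=> {}P {}Q.
apply: crossed_iso_pure => //.
- exact: psi_linear.
- exact: psi_pure.
- exact: times_ext.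
by exists (@smash_to_times _ _ _ rho); [exact: psiK|exact: smash_to_timesK].
Qed.
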